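(* Let $\mathcal{U}$ be a quasi-definite vector of linear functionals, and let $\{\mathcal{B}_m\}_{m\in\mathbb{N}}$, $\mathcal{B}_m(x)=V_m(h(x))\mathcal{P}_0(x)$, and $\{G_m\}_{m\in\mathbb{N}}$ be, respectively, the left vector orthogonal polynomials and the right matrix orthogonal polynomials with respect to $\mathcal{U}$, bi-orthogonal to each other. Let $\pi\in\mathbb{P}^N$ be a vector polynomial of degree $m$, i.e. $\pi(x)=\sum_{k=0}^m\beta_k^m\mathcal{B}_k(x)$ with $\beta_k^m\in\mathcal{M}_{N\times N}(\mathbb{C})$. Then $$\pi(x)=\big(K_{m+1}^T(x,z)\,\mathcal{U}_z\big)(\pi(z))\,\mathcal{P}_0(x),$$ where $K_{m+1}(x,z)=\sum_{k=0}^{m}G_k(h(z))V_k(h(x))$.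
   Context: Fix $N\ge 1$ and a complex polynomial $h$ of degree $N$. $\mathbb{P}^N$ is the space of vector polynomials $\mathcal{P}=[p_1,\dots,p_N]^T$, $p_i\in\mathbb{C}[x]$; the degree of $\mathcal{P}$ is $\lfloor(\max_j\deg p_j)/N\rfloor$. Put $\mathcal{P}_0(x)=[1,x,\dots,x^{N-1}]^T$ and $\mathcal{P}_j=h^j\mathcal{P}_0$. A vector of linear functionals $\mathcal{U}=[u^1,\dots,u^N]^T$ consists of linear functionals on $\mathbb{C}[x]$; $\mathcal{U}(\mathcal{P})$ is the $N\times N$ matrix with $(i,j)$ entry $\langle u^j,p_i\rangle$. One sets $(h^k\mathcal{U})(\mathcal{P})=\mathcal{U}(h^k\mathcal{P})$ and, for a matrix polynomial $G(z)=\sum_k\beta_kz^k$, $(G^T(h)\mathcal{U})(\mathcal{P})=\sum_k\mathcal{U}(h^k\mathcal{P})\beta_k$. The subscript in $\mathcal{U}_z$ indicates the variable acted on; in $K_{m+1}^T(x,z)\mathcal{U}_z$ the variable $x$ is a parameter and $K_{m+1}(x,z)$ is regarded as a matrix polynomial in $h(z)$. With $\mathcal{U}_j=\mathcal{U}(\mathcal{P}_j)$, $\mathcal{U}$ is quasi-definite if all leading principal submatrices of $[\mathcal{U}_{i+j}]_{i,j=0}^m$, $m\in\mathbb{N}$, are non-singular. $\{\mathcal{B}_m\}$, $\deg\mathcal{B}_m=m$, is left-orthogonal with respect to $\mathcal{U}$ if $(h^k\mathcal{U})(\mathcal{B}_m)=\Delta_m\delta_{k,m}$, $k=0,\dots,m$,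 with $\Delta_m$ non-singular upper triangular; a sequence of matrix polynomials $\{G_m\}$, $\deg G_m=m$, is right-orthogonal if $(G_m^T(h)\mathcal{U})(\mathcal{P}_j)=\Theta_m\delta_{j,m}$, $j=0,\dots,m$, with $\Theta_m$ non-singular lower triangular. They are bi-orthogonal if $((G_n(h(x)))^T\mathcal{U}_x)(\mathcal{B}_m)=I_{N\times N}\delta_{n,m}$ for all $n,m$. *)

(* Defs.v *)
From HB Require Import structures.
From mathcomp Require Export all_boot all_order all_algebra.
From mathcomp Require Export reals.
From mathcomp Require Export complex.

Set Implicit Arguments.
Unset Strict Implicit.
Unset Printing Implicit Defensive.

Import GRing.Theory.
Local Open Scope ring_scope.

Section VectorPolynomials.

(* N = n.+1, so that N >= 1 and 'M[F]_N is a nontrivial ring. *)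
Variables (F : fieldType) (n : nat).
Local Notation N := n.+1.

Definition vpoly := 'cV[{poly F}]_N.

Definition vmpoly := {poly 'M[F]_N}.

Implicit Types (h : {poly F}) (P : vpoly) (G : vmpoly).

Definition veval P (x : F) : 'cV[F]_N := map_mx (horner^~ x) P.

(* The zero polynomial is counted with degree 0. *)
Definition vdeg P : nat := (\max_(i < N) (size (P i 0%R)).-1) %/ N.

Definition vP0 : vpoly := \col_(i < N) 'X^i.

Definition vP h (j : nat) : vpoly := h ^+ j *: vP0.

(* G(y) at a scalar y. *)
Definition mpeval G (y : F) : 'M[F]_N := G.[y%:M].

Definition vfun := 'I_N -> {scalar {poly F}}.

Definition vapply (U : vfun) P : 'M[F]_N := \matrix_(i, j) U j (P i 0%R).

(* (h^k U)(P) *)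
Definition hpow_apply h (k : nat) (U : vfun) P : 'M[F]_N :=
  vapply U (h ^+ k *: P).

(* (G^T(h) U)(P) *)
Definition mp_apply h G (U : vfun) P : 'M[F]_N :=
  \sum_(k < size G) hpow_apply h k U P *m G`_k.

Definition moment h (U : vfun) (j : nat) : 'M[F]_N := vapply U (vP h j).

Definition hankel h (U : vfun) (m : nat) :
    'M[F]_(\sum_(i < m.+1) N, \sum_(j < m.+1) N) :=
  \mxblock_(i < m.+1, j < m.+1) moment h U (i + j).

(* The leading principal submatrices are those of every scalar order k, not
   only those cut along the N x N blocks. *)
Definition quasi_definite h (U : vfun) : Prop :=
  forall (m k : nat) (le_k : (k <= \sum_(i < m.+1) N)%N),
    mxsub (widen_ord le_k) (widen_ord le_k) (hankel h U m) \in unitmx.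

(* is_trig_mx means lower triangular. *)
Definition left_orthogonal h (U : vfun) (B : nat -> vpoly) : Prop :=
  (forall m, vdeg (B m) = m) /\
  exists Delta : nat -> 'M[F]_N,
    (forall m, Delta m \in unitmx /\ is_trig_mx (Delta m)^T) /\
    (forall m k, (k <= m)%N ->
       hpow_apply h k U (B m) = Delta m *+ (k == m)).

Definition right_orthogonal h (U : vfun) (G : nat -> vmpoly) : Prop :=
  (forall m, size (G m) = m.+1) /\
  exists Theta : nat -> 'M[F]_N,
    (forall m, Theta m \in unitmx /\ is_trig_mx (Theta m)) /\
    (forall m j, (j <= m)%N ->
       mp_apply h (G m) U (vP h j) = Theta m *+ (j == m)).

Definition bi_orthogonal h (U : vfun) (B : nat -> vpoly)
    (G : nat -> vmpoly) : Prop :=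
  forall n' m, mp_apply h (G n') U (B m) = 1%:M *+ (n' == m).

(* K_(m+1)(x, z) for a fixed x, as a matrix polynomial in w = h(z):
   \sum_(k <= m) G_k(w) V_k(h(x)); see kernelE. *)
Definition kernel h (G V : nat -> vmpoly) (m : nat) (x : F) : vmpoly :=
  \sum_(k < m.+1) G k * (mpeval (V k) h.[x])%:P.

Lemma kernelE h (G V : nat -> vmpoly) (m : nat) (x z : F) :
  mpeval (kernel h G V m x) h.[z] =
  \sum_(k < m.+1) mpeval (G k) h.[z] *m mpeval (V k) h.[x].
Proof.
rewrite /mpeval /kernel horner_sum; apply: eq_bigr => k _.
rewrite hornerM_comm ?hornerC //.
by rewrite /comm_poly hornerC; apply/esym/scalar_mxC.
Qed.

End VectorPolynomials.

(* Main.v *)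
Require Import Defs.
Set Implicit Arguments.
Unset Strict Implicit.
Unset Printing Implicit Defensive.
Import GRing.Theory.
Local Open Scope ring_scope.
Local Open Scope complex_scope.

(** The vector polynomials form a left module over the constant matrices, and
    everything rests on which side of [mp_apply h G U P] a matrix comes out:
    constants multiplying [P] come out on the left ([mp_apply_mull]), constants
    multiplying [G] on the right ([mp_apply_mulr]).  Hence, if
    [p = \sum_(j <= m) beta j * B j], bi-orthogonality collapses the kernel
    [\sum_(k <= m) G k * V k (h x)] applied to [p] into
    [\sum_(k <= m) beta k * V k (h x)], and multiplying on the right by [vP0] at
    [x] turns every [V k (h x)] into [B k] at [x].

    It remains to see that [p] is such a combination.  Repeated division by [h]
    writes every vector polynomial of degree at most [m] as a combination of
    the [vP n h j] with [j <= m] ([block_span_vP]).  In particular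
    [B k = \sum_(j <= k) D j * vP n h j], and applying [G k] to this identity gives
    [1 = D k * Theta k] by bi-orthogonality and right-orthogonality, so the
    leading coefficient [D k] is invertible ([biorthogonal_triangular]).  A
    block triangular change of family with invertible diagonal then replaces
    the [vP n h j] by the [B j] ([block_span_triangular]). *)

Local Notation "C %:PM" := (map_mx polyC C) (at level 2, left associativity,
  format "C %:PM") : ring_scope.

Section Expansion.

Variables (F : fieldType) (n : nat).
Local Notation N := n.+1.
Implicit Types (h : {poly F}) (P p : vpoly F n) (C : 'M[F]_N) (G : vmpoly F n).
Implicit Types (U : vfun F n) (x : F).

Lemma veval_mull C P x : veval (C%:PM *m P) x = C *m veval P x.
Proof.
apply/matrixP => i j; rewrite !mxE horner_sum; apply: eq_bigr => l _.
by rewrite !mxE hornerM hornerC.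
Qed.

Lemma veval_sum (I : Type) (r : seq I) (Q : I -> vpoly F n) x :
  veval (\sum_(k <- r) Q k) x = \sum_(k <- r) veval (Q k) x.
Proof.
apply/matrixP => i j; rewrite !mxE !summxE horner_sum.
by apply: eq_bigr => k _; rewrite mxE.
Qed.

Lemma vapplyD U P p : vapply U (P + p) = vapply U P + vapply U p.
Proof. by apply/matrixP => i j; rewrite !mxE linearD. Qed.

Lemma vapply_mull U C P : vapply U (C%:PM *m P) = C *m vapply U P.
Proof.
apply/matrixP => i j; rewrite !mxE linear_sum; apply: eq_bigr => l _.
by rewrite !mxE mul_polyC linearZ.
Qed.

(** Allowing any bound [s] beyond the degree makes linearity in [G] visible,
    since the size of a sum or product is not a function of the sizes. *)
Lemma mp_apply_wide h G U P s : (size G <= s)%N ->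
  mp_apply h G U P = \sum_(k < s) hpow_apply h k U P *m G`_k.
Proof.
move=> le_Gs; rewrite /mp_apply.
rewrite (big_ord_widen s (fun k => hpow_apply h k U P *m G`_k)) // big_mkcond.
apply: eq_bigr => k _.
by case: ltnP => // le_Gk; rewrite nth_default ?mulmx0.
Qed.

Lemma mp_applyDr h G U P p :
  mp_apply h G U (P + p) = mp_apply h G U P + mp_apply h G U p.
Proof.
rewrite /mp_apply -big_split; apply: eq_bigr => k _ /=.
by rewrite /hpow_apply scalerDr vapplyD mulmxDl.
Qed.

Lemma mp_apply_mull h G U C P :
  mp_apply h G U (C%:PM *m P) = C *m mp_apply h G U P.
Proof.
rewrite /mp_apply mulmx_sumr; apply: eq_bigr => k _.
by rewrite /hpow_apply scalemxAr vapply_mull mulmxA.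
Qed.

Lemma mp_apply0r h G U : mp_apply h G U 0 = 0.
Proof.
by apply: (addrI (mp_apply h G U 0)); rewrite -mp_applyDr !addr0.
Qed.

Lemma mp_apply_comb h G U (I : Type) (r : seq I) (A : I -> 'M[F]_N)
    (Q : I -> vpoly F n) :
  mp_apply h G U (\sum_(j <- r) (A j)%:PM *m Q j) =
  \sum_(j <- r) A j *m mp_apply h G U (Q j).
Proof.
elim: r => [|j r IHr]; first by rewrite !big_nil mp_apply0r.
by rewrite !big_cons mp_applyDr IHr mp_apply_mull.
Qed.

Lemma mp_applyDl h G G' U P :
  mp_apply h (G + G') U P = mp_apply h G U P + mp_apply h G' U P.
Proof.
pose s := maxn (size G) (size G').
rewrite (mp_apply_wide h U P (size_polyD G G')).
rewrite (@mp_apply_wide h G U P s) ?leq_maxl //.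
rewrite (@mp_apply_wide h G' U P s) ?leq_maxr // -big_split.
by apply: eq_bigr => k _; rewrite coefD mulmxDr.
Qed.

Lemma mp_apply0l h U P : mp_apply h 0 U P = 0.
Proof. by rewrite /mp_apply size_poly0 big_ord0. Qed.

Lemma mp_apply_mulr h G U C P :
  mp_apply h (G * C%:P) U P = mp_apply h G U P *m C.
Proof.
rewrite (@mp_apply_wide h (G * C%:P) U P (size G)); last first.
  by apply/leq_sizeP => j le_Gj; rewrite coefMC nth_default ?mul0r.
rewrite /mp_apply mulmx_suml; apply: eq_bigr => k _.
by rewrite coefMC mulmxA.
Qed.

Lemma mp_apply_kernel h (G V : nat -> vmpoly F n) m x U P :
  mp_apply h (kernel h G V m x) U P =
  \sum_(k < m.+1) mp_apply h (G k) U P *m mpeval (V k) h.[x].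
Proof.
rewrite /kernel; elim/big_rec2: _ => [|k y K _ <-]; first exact: mp_apply0l.
by rewrite mp_applyDl mp_apply_mulr.
Qed.

Definition block_span (Q : nat -> vpoly F n) (m : nat) P : Prop :=
  exists A : nat -> 'M[F]_N, P = \sum_(j < m) (A j)%:PM *m Q j.

Lemma vP0_coef P : (forall i, size (P i 0%R) <= N)%N ->
  P = (\matrix_(i, j < N) (P i 0)`_j)%:PM *m vP0 F n.
Proof.
move=> leP; apply/matrixP => i j; rewrite ord1 mxE.
rewrite -[LHS](@coefK _ (P i 0)) poly_def.
rewrite (big_ord_widen N (fun k => (P i 0)`_k *: 'X^k)) ?leP // big_mkcond.
apply: eq_bigr => k _; rewrite !mxE mul_polyC.
by case: ltnP => // lePk; rewrite nth_default ?scale0r.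
Qed.

(** This is the expansion in base [h]: the digits are vectors of polynomials of
    degree less than [N = deg h], that is, constant multiples of [vP0]. *)
Lemma block_span_vP h m P : size h = n.+2 ->
  (forall i, size (P i 0%R) <= m * N)%N -> block_span (vP n h) m P.
Proof.
move=> sz_h; elim: m P => [|m IHm] P leP.
  exists (fun=> 0); rewrite big_ord0; apply/matrixP => i j.
  by rewrite ord1 mxE; apply/eqP; rewrite -size_poly_leq0; apply: leP.
have h_neq0 : h != 0 by rewrite -size_poly_eq0 sz_h.
pose Q : vpoly F n := map_mx (fun q => q %/ h)%R P.
pose r : vpoly F n := map_mx (fun q => q %% h)%R P.
have [i|A def_Q] := IHm Q.
  by rewrite mxE size_divp // sz_h leq_subLR -mulSn; apply: leP.
have ler i : (size (r i 0%R) <= N)%N.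
  by rewrite mxE -ltnS -[n.+2]sz_h ltn_modp.
pose D := \matrix_(i, j < N) (r i 0)`_j.
exists (fun j => if j is j'.+1 then A j' else D).
rewrite big_ord_recl /= /vP expr0 scale1r -(vP0_coef ler).
have ->: P = r + h *: Q.
  by apply/matrixP => i j; rewrite !mxE addrC mulrC -divp_eq.
congr (_ + _); rewrite def_Q scaler_sumr; apply: eq_bigr => j _.
by rewrite /vP scalemxAr scalerA -exprS.
Qed.

Lemma block_span_vdeg h m P : size h = n.+2 -> vdeg P = m ->
  block_span (vP n h) m.+1 P.
Proof.
move=> sz_h degP; apply: block_span_vP => // i.
(* The quotient of the largest degree by [N] is [m], so that degree is less
   than [(m + 1) N]. *)
have: (\max_(j < N) (size (P j 0%R)).-1 < m.+1 * N)%N.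
  by rewrite -ltn_divLR // -degP ltnS.
apply: leq_trans; apply: leq_trans (leqSpred _) _; rewrite ltnS.
exact: (leq_bigmax (F := fun j : 'I_N => (size (P j 0)).-1)).
Qed.

(** Inverting a block triangular change of family: dividing by the last
    diagonal coefficient, a multiple of [Q m] cancels the top term. *)
Lemma block_span_triangular (P Q : nat -> vpoly F n) :
  (forall k, exists2 D : nat -> 'M[F]_N,
     D k \in unitmx & Q k = \sum_(j < k.+1) (D j)%:PM *m P j) ->
  forall m p, block_span P m p -> block_span Q m p.
Proof.
move=> triQ; elim=> [|m IHm] p [A def_p].
  by exists A; rewrite def_p !big_ord0.
have [D unitD def_Q] := triQ m.
pose b := A m *m invmx (D m).
have [|beta def_pb] := IHm (p - b%:PM *m Q m).
  exists (fun j => A j - b *m D j).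
  rewrite def_p def_Q !big_ord_recr /= mulmxDr mulmx_sumr.
  rewrite [b%:PM *m ((D m)%:PM *m _)]mulmxA -map_mxM mulmxKV //.
  rewrite opprD addrACA subrr addr0 -sumrB; apply: eq_bigr => j _.
  by rewrite mulmxA -map_mxM -mulmxBl -map_mxB.
exists (fun j => if j == m then b else beta j).
rewrite big_ord_recr /= eqxx -[LHS](subrK (b%:PM *m Q m)) def_pb.
by congr (_ + _); apply: eq_bigr => j _; rewrite ltn_eqF.
Qed.

(** Applying [G k] to the expansion of [B k] in the [vP n h j] keeps the top term
    only, so that [Theta k] is an inverse of the leading coefficient. *)
Lemma biorthogonal_triangular h U (B : nat -> vpoly F n)
    (G : nat -> vmpoly F n) :
  size h = n.+2 -> (forall k, vdeg (B k) = k) ->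
  right_orthogonal h U G -> bi_orthogonal h U B G ->
  forall k, exists2 D : nat -> 'M[F]_N,
    D k \in unitmx & B k = \sum_(j < k.+1) (D j)%:PM *m vP n h j.
Proof.
move=> sz_h degB [_ [Theta [_ orthG]]] biBG k.
have [D def_B] := block_span_vdeg sz_h (degB k).
exists D => //; have := biBG k k.
rewrite eqxx mulr1n def_B mp_apply_comb big_ord_recr /= big1 => [|j _].
  by rewrite add0r orthG // eqxx mulr1n => /mulmx1_unit[].
by rewrite orthG 1?ltnW // ltn_eqF // mulr0n mulmx0.
Qed.

(** The reproducing property, by orthogonality of [G k] to [B j] for [j != k]. *)
Lemma kernel_reproducing h U (B : nat -> vpoly F n) (V G : nat -> vmpoly F n)
    (beta : nat -> 'M[F]_N) m x :
  bi_orthogonal h U B G ->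
  (forall k, veval (B k) x = mpeval (V k) h.[x] *m veval (vP0 F n) x) ->
  let p := \sum_(j < m.+1) (beta j)%:PM *m B j in
  veval p x = mp_apply h (kernel h G V m x) U p *m veval (vP0 F n) x.
Proof.
move=> biBG VB p; rewrite mp_apply_kernel mulmx_suml veval_sum.
apply: eq_bigr => k _; rewrite veval_mull VB -!mulmxA; congr (_ *m _).
rewrite mp_apply_comb (bigD1 k) //= big1 => [|j neq_jk].
  by rewrite biBG eqxx mulr1n mulmx1 addr0.
by rewrite biBG eq_sym (negPf neq_jk : (j == k :> nat) = false) mulr0n mulmx0.
Qed.

End Expansion.

Theorem theorem2 (R : realType) (n : nat) (h : {poly R[i]})
    (U : vfun R[i] n) (B : nat -> vpoly R[i] n) (V G : nat -> vmpoly R[i] n)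
    (m : nat) (p : vpoly R[i] n) :
  size h = n.+2 ->
  quasi_definite h U ->
  (forall (k : nat) (x : R[i]),
     veval (B k) x = mpeval (V k) h.[x] *m veval (vP0 R[i] n) x) ->
  left_orthogonal h U B ->
  right_orthogonal h U G ->
  bi_orthogonal h U B G ->
  vdeg p = m ->
  (exists beta : nat -> 'M[R[i]]_n.+1, forall x : R[i],
     veval p x = \sum_(k < m.+1) beta k *m veval (B k) x) /\
  (forall x : R[i],
     veval p x = mp_apply h (kernel h G V m x) U p *m veval (vP0 R[i] n) x).
Proof.
move=> sz_h _ VB [degB _] orthG biBG degp.
have triB := biorthogonal_triangular sz_h degB orthG biBG.
have [beta ->] := block_span_triangular triB (block_span_vdeg sz_h degp).
split=> [|x]; last exact: kernel_reproducing.
exists beta => x; rewrite veval_sum; apply: eq_bigr => k _.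
exact: veval_mull.
Qed.
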